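(* Let $M$ and $N$ be singular $(G,X)$-manifolds and let $f:M\to N$ be an a.e. $(G,X)$-morphism. Then $$\mathrm{Reg}(f)=\mathrm{Reg}(M)\cap\{x\in M\mid f\text{ is a local homeomorphism around }x\}.$$
   Context: $(G,X)$ is an analytical structure: $X$ is a connected, locally connected, Hausdorff topological space and $G$ is a group acting faithfully on $X$ by homeomorphisms such that for all $\phi_1,\phi_2\in G$ and every nonempty open $U\subset X$, if $\phi_1$ and $\phi_2$ agree on $U$ they agree on $X$. A $(G,X)$-atlas is an atlas of charts valued in open subsets of $X$ whose changes of charts are locally restrictions of elements of $G$; a $(G,X)$-morphism is a map which in such charts is locally the restriction of an element of $G$. A subset $U$ of a space $M$ is portly if it is open, dense and locally connected in $M$ (i.e. $W\cap U$ is connected for every open connected $W\subset M$). An almost everywhere (a.e.) $(G,X)$-structure on $M$ is given by a $(G,X)$-atlas on some portly subset of $M$. Any such a.e. structure has a maximal extension (extending both the portly domain and the atlas). A singular $(G,X)$-manifold is a locally connected Hausdorff second countable space $M$ endowed with a maximal a.e. $(G,X)$-structure; its regular locus $\mathrm{Reg}(M)$ is the portly subset on which this maximal structure is defined, and $\mathrm{Sing}(M)=M\setminus\mathrm{Reg}(M)$. An a.e. $(G,X)$-morphism $f:M\to N$ between singular $(G,X)$-manifolds is a continuous map for which there exist portly subsets $U\subset\mathrm{Reg}(M)$ and $V\subset\mathrm{Reg}(N)$ such that $f$ restricts to a $(G,X)$-morphism $U\to V$. Its regular locus $\mathrm{Reg}(f)$ is the largest open subset $U\subset\mathrm{Reg}(M)$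 such that $f$ induces a $(G,X)$-morphism $U\to\mathrm{Reg}(N)$ (it exists). *)

(* Defs.v *)
From HB Require Import structures.
From mathcomp Require Import all_boot.
From mathcomp Require Import boolp classical_sets functions cardinality.
From mathcomp Require Import topology.

Set Implicit Arguments.
Unset Strict Implicit.
Unset Printing Implicit Defensive.

Local Open Scope classical_set_scope.

(** * Topology *)

Definition locally_connected (T : topologicalType) : Prop :=
  forall (x : T) (U : set T), nbhs x U ->
    exists W : set T, [/\ open W, connected W, W x & W `<=` U].

(* The last clause is the continuity of the inverse bijection E -> D; it is
   phrased with images because an inverse defined on all of T need not exist
   when S is empty. *)
Definition homeomorphism_between (S T : topologicalType)
    (D : set S) (E : set T) (h : S -> T) : Prop :=
  [/\ set_bij D E h,
      {within D, continuous h} &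
      forall O : set S, open O ->
        exists2 O' : set T, open O' & h @` (D `&` O) = E `&` O'].

Definition local_homeomorphism_at (S T : topologicalType) (h : S -> T)
    (x : S) : Prop :=
  exists W : set S,
    [/\ open W, W x, open (h @` W) & homeomorphism_between W (h @` W) h].

Definition portly (T : topologicalType) (U : set T) : Prop :=
  [/\ open U, dense U &
      forall W : set T, open W -> connected W -> connected (W `&` U)].

(** * Analytical structures *)

Definition analytical_structure (G : groupType) (X : topologicalType)
    (act : G -> X -> X) : Prop :=
  [/\ [/\ connected [set: X], locally_connected X & hausdorff_space X],
      [/\ forall x, act 1%g x = x &
          forall g h x, act (g * h)%g x = act g (act h x)],
      forall g, continuous (act g),
      forall g, (forall x, act g x = x) -> g = 1%g &
      forall (g h : G) (U : set X), open U -> U !=set0 ->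
        {in U, act g =1 act h} -> act g =1 act h].

(** * Charts, atlases and morphisms *)

(* The values of [coord] outside [dom] are irrelevant. *)
Record chart (M X : Type) := Chart { dom : set M; coord : M -> X }.

Definition is_chart (M X : topologicalType) (c : chart M X) : Prop :=
  [/\ open (dom c), open (coord c @` dom c) &
      homeomorphism_between (dom c) (coord c @` dom c) (coord c)].

(* The partial map psi \o (phi|_D)^-1 of X, defined on phi(D), coincides with
   an element of G on an open neighbourhood of phi x contained in phi(D). *)
Definition locally_in_group (G : groupType) (X : topologicalType)
    (act : G -> X -> X) (M : Type) (D : set M) (phi psi : M -> X) (x : M) :
    Prop :=
  exists (g : G) (O : set X),
    [/\ open O, O (phi x), O `<=` phi @` D &
        forall y, D y -> O (phi y) -> psi y = act g (phi y)].

Definition gx_atlas (G : groupType) (X : topologicalType) (act : G -> X -> X)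
    (M : topologicalType) (U : set M) (A : set (chart M X)) : Prop :=
  [/\ forall c, A c -> is_chart c /\ dom c `<=` U,
      U `<=` \bigcup_(c in A) dom c &
      forall c d, A c -> A d -> forall x, dom c x -> dom d x ->
        locally_in_group act (dom c `&` dom d) (coord c) (coord d) x].

Definition atlas_restr (M X : Type) (A : set (chart M X)) (U : set M) :
    set (chart M X) :=
  [set Chart (dom c `&` U) (coord c) | c in A].

(* f restricts to a morphism from U, with atlas A, to V, with atlas B.  The
   open neighbourhood provided by [locally_in_group] lies in the image of
   dom c `&` f @^-1` dom d, which makes f continuous on U. *)
Definition gx_morphism (G : groupType) (X : topologicalType)
    (act : G -> X -> X) (M N : topologicalType)
    (U : set M) (A : set (chart M X)) (V : set N) (B : set (chart N X))
    (f : M -> N) : Prop :=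
  (forall x, U x -> V (f x)) /\
  (forall c d, A c -> B d -> forall x, dom c x -> dom d (f x) ->
     locally_in_group act (dom c `&` f @^-1` dom d)
       (coord c) (coord d \o f) x).

(** * Singular manifolds *)

Definition ae_structure (G : groupType) (X : topologicalType)
    (act : G -> X -> X) (M : topologicalType)
    (U : set M) (A : set (chart M X)) : Prop :=
  portly U /\ gx_atlas act U A.

Definition maximal_ae_structure (G : groupType) (X : topologicalType)
    (act : G -> X -> X) (M : topologicalType)
    (U : set M) (A : set (chart M X)) : Prop :=
  ae_structure act U A /\
  forall (U' : set M) (A' : set (chart M X)),
    ae_structure act U' A' -> U `<=` U' -> A `<=` A' -> U' = U /\ A' = A.

Record singular_manifold (G : groupType) (X : topologicalType)
    (act : G -> X -> X) := SingularManifold {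
  sm_space :> topologicalType;
  Reg : set sm_space;
  sm_atlas : set (chart sm_space X);
  sm_locally_connected : locally_connected sm_space;
  sm_hausdorff : hausdorff_space sm_space;
  sm_second_countable : @second_countable sm_space;
  sm_maximal : maximal_ae_structure act Reg sm_atlas }.

Arguments Reg {G X act} s _.
Arguments sm_atlas {G X act} s _.

Definition ae_morphism (G : groupType) (X : topologicalType)
    (act : G -> X -> X) (M N : singular_manifold act) (f : M -> N) : Prop :=
  continuous f /\
  exists (U : set M) (V : set N),
    [/\ portly U /\ U `<=` Reg M, portly V /\ V `<=` Reg N &
        gx_morphism act U (atlas_restr (sm_atlas M) U)
                        V (atlas_restr (sm_atlas N) V) f].

Definition regular_on (G : groupType) (X : topologicalType)
    (act : G -> X -> X) (M N : singular_manifold act) (f : M -> N)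
    (U : set M) : Prop :=
  [/\ open U, U `<=` Reg M &
      gx_morphism act U (atlas_restr (sm_atlas M) U) (Reg N) (sm_atlas N) f].

Definition Reg_morphism (G : groupType) (X : topologicalType)
    (act : G -> X -> X) (M N : singular_manifold act) (f : M -> N) : set M :=
  \bigcup_(U in [set U | regular_on f U]) U.

Lemma Reg_morphism_largest (G : groupType) (X : topologicalType)
    (act : G -> X -> X) (M N : singular_manifold act) (f : M -> N) :
  regular_on f (Reg_morphism f) /\
  forall U : set M, regular_on f U -> U `<=` Reg_morphism f.
Proof.
split; last by move=> U fU x Ux; exists U.
split.
- by apply: bigcup_open => U [].
- by move=> x [U [_ UM _] /UM].
split=> [x [U [_ _ [UN _]] /UN//]|_ d [c Ac <-] Bd x /= [cx [U fU Ux]] dfx].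
have [_ _ [_ morU]] := fU.
have AUc : atlas_restr (sm_atlas M) U (Chart (dom c `&` U) (coord c)).
  by exists c.
have [g [O [oO Ox OD E]]] := morU _ _ AUc Bd x (conj cx Ux) dfx.
exists g, O; split=> // y.
  by move=> /OD [z /= [[cz Uz] dz] <-]; exists z => //; do !split=> //; exists U.
move=> [[cy _] _] Oy; have [z /= [[cz Uz] dz] zy] := OD _ Oy.
have [[_ [charts _ _]] _] := sm_maximal M.
have [[_ _ [[_ injc _] _ _]] _] := charts c Ac.
have yz : y = z by apply: injc; rewrite ?inE.
by apply: E => //; rewrite yz.
Qed.

(* Main.v *)
Require Import Defs.
From HB Require Import structures.
From mathcomp Require Import all_boot.
From mathcomp Require Import boolp classical_sets functions cardinality.
From mathcomp Require Import topology.

Local Open Scope classical_set_scope.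

(** The heart of the matter is that an a.e. morphism [f] is automatically a
    morphism at every point [x] of [Reg M] such that [f x] lies in [Reg N],
    however far the portly sets [U] and [V] of its definition are from [x] and
    [f x] ([ae_morphism_germ]).  Take charts [c] at [x] and [d] at [f x], and a
    connected open neighbourhood [W] of [x] on which both [c] and [d \o f] are
    defined.  Since [U] is portly, [W `&` U] is connected and dense in [W].  On
    it, [d \o f] is locally of the form [g \o c] with [g] in the group; as an
    element of the group is determined by its values on a nonempty open set,
    [g] is locally constant, hence constant ([analytic_continuation]).  The
    identity [d \o f = g \o c] extends to [W] by density and continuity,
    because [X] is Hausdorff.

    If [x] is in [Reg_morphism f], this identity shows that [f] is, near [x],
    the composite of [c], of the homeomorphism [g] and of the inverse of [d],
    so a local homeomorphism ([Reg_morphism_local_homeomorphism]).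

    Conversely, if [f] is a local homeomorphism at a point [x] of [Reg M], it
    only remains to see that [f] maps a neighbourhood of [x] to [Reg N].  For a
    small open neighbourhood [P] of [x], [c \o f^-1] is a chart of [N] with
    domain [f @` P], and the same identity says that it is compatible with
    every chart of the atlas of [N].  An open set containing a portly set is
    portly ([portly_superset]), so adding this chart gives again an a.e.
    structure; by maximality, it already belonged to the atlas
    ([sm_atlas_maximal]) and [f @` P] is contained in [Reg N]
    ([local_homeomorphism_regular_value]).

    Changes of charts are handled through germs ([germ_in_group]) rather than
    through partial maps between open subsets of [X]; the two are equivalent
    because charts are open embeddings ([locally_in_groupP]). *)

(** * Open embeddings *)

(** Homeomorphisms between open sets, in a form that is stable under
    restriction and composition without mentioning the image. *)
Definition open_embedding {S T : topologicalType} (D : set S) (h : S -> T) :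
    Prop :=
  [/\ open D, {in D &, injective h}, {in D, continuous h} &
      forall O, open O -> open (h @` (D `&` O))].

Lemma homeomorphism_open_embedding {S T : topologicalType} (D : set S)
    (h : S -> T) :
  open_embedding D h <->
  [/\ open D, open (h @` D) & homeomorphism_between D (h @` D) h].
Proof.
split=> [[oD injh ch oh]|[oD ohD [[_ injh _] ch oh]]].
  have ohD : open (h @` D) by rewrite -[D]setIT; apply: oh; exact: openT.
  split=> //; split.
  - by split=> // x Dx; exists x.
  - by rewrite continuous_open_subspace.
  - move=> O oO; exists (h @` (D `&` O)); first exact: oh.
    by rewrite [RHS]setIidr // => _ [x [Dx _] <-]; exists x.
split=> //; first by rewrite -continuous_open_subspace.
by move=> O /oh [O' oO' ->]; exact: openI.
Qed.

Section OpenEmbedding.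
Context {R S T : topologicalType}.

Lemma open_embedding_sub (D E : set S) (h : S -> T) :
  open_embedding D h -> open E -> E `<=` D -> open_embedding E h.
Proof.
move=> [oD injh ch oh] oE ED; split=> //.
- by move=> x y; rewrite !inE => /ED Dx /ED Dy; apply: injh; rewrite inE.
- by move=> x; rewrite inE => /ED Dx; apply: ch; rewrite inE.
- move=> O oO; have -> : E `&` O = D `&` (E `&` O).
    by rewrite setIA (setIidr ED).
  by apply: oh; exact: openI.
Qed.

Lemma open_embedding_image (D E : set S) (h : S -> T) :
  open_embedding D h -> open E -> E `<=` D -> open (h @` E).
Proof.
by move=> [_ _ _ oh] oE /setIidr <-; exact: oh.
Qed.

Lemma open_embedding_preimage (D : set S) (O : set T) (h : S -> T) :
  open_embedding D h -> open O -> open (D `&` h @^-1` O).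
Proof. by move=> [oD _ ch _] oO; move/(continuous_inP _ oD): ch; exact. Qed.

Lemma open_embedding_comp (D : set R) (E : set S) (h : R -> S) (k : S -> T) :
  open_embedding D h -> open_embedding E k -> h @` D `<=` E ->
  open_embedding D (k \o h).
Proof.
move=> hD kE hDE; have [oD injh ch oh] := hD; have [oE injk ck ok] := kE.
have DE x : D x -> E (h x) by move=> Dx; apply: hDE; exists x.
split=> //.
- move=> x y Dx Dy /= /injk; rewrite !inE => xy; apply: injh => //.
  by apply: xy; apply: DE; apply/set_mem.
- move=> x Dx; apply: continuous_comp; first exact: ch.
  by apply: ck; rewrite inE; apply: DE; apply/set_mem.
- move=> O oO; rewrite -image_comp; apply: open_embedding_image kE _ _.
    exact: oh.
  by move=> _ [x [Dx _] <-]; exact: DE.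
Qed.

(** [h] coincides with [k \o h] followed by the inverse of [k], which is an
    open map on the image of [k]. *)
Lemma open_embedding_cancel (D : set R) (E : set S) (h : R -> S) (k : S -> T) :
  {in D, continuous h} -> open_embedding E k -> h @` D `<=` E ->
  open_embedding D (k \o h) -> open_embedding D h.
Proof.
move=> ch kE hDE [oD injkh _ okh]; have [_ injk _ _] := kE.
split=> //; first by move=> x y Dx Dy xy; apply: injkh => //=; rewrite xy.
move=> O /okh okhO; have -> : h @` (D `&` O) =
    E `&` k @^-1` ((k \o h) @` (D `&` O)).
  apply/seteqP; split=> [_ [x [Dx Ox] <-]|y [Ey [x [Dx Ox] /= kxy]]].
    by split; [apply: hDE; exists x | exists x].
  exists x => //; apply: injk; rewrite ?inE //; apply: hDE; exists x => //.
by apply: open_embedding_preimage.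
Qed.

Lemma open_embedding_eq (D : set S) (h k : S -> T) :
  {in D, h =1 k} -> open_embedding D h -> open_embedding D k.
Proof.
move=> hk [oD injh ch oh]; split=> //.
- by move=> x y Dx Dy; rewrite -!hk //; exact: injh.
- rewrite -continuous_open_subspace //; apply: subspace_eq_continuous hk _.
  by rewrite -continuous_open_subspace in ch.
- move=> O oO; have <- : h @` (D `&` O) = k @` (D `&` O); last exact: oh.
  by apply: eq_imagel => x [Dx _]; apply: hk; rewrite inE.
Qed.

Lemma open_embedding_inverse (D : set S) (h : S -> T) (h' : T -> S) :
  open_embedding D h -> {in D, cancel h h'} -> open_embedding (h @` D) h'.
Proof.
move=> hD h'K; have [oD injh ch oh] := hD.
have h'hK x : D x -> h' (h x) = x by move=> Dx; rewrite h'K ?inE.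
split=> //.
- exact: open_embedding_image hD oD _.
- move=> _ _ /set_mem[x Dx <-] /set_mem[y Dy <-].
  by rewrite !h'hK // => ->.
- apply/continuous_inP => [|O oO]; first exact: open_embedding_image hD oD _.
  have -> : h @` D `&` h' @^-1` O = h @` (D `&` O); last exact: oh.
  apply/seteqP; split=> [_ [[x Dx <-] /=]|_ [x [Dx Ox] <-]].
    by rewrite h'hK // => Ox; exists x.
  by split; [exists x | rewrite /= h'hK].
- move=> O oO; have -> : h' @` (h @` D `&` O) = D `&` h @^-1` O.
    apply/seteqP; split=> [_ [_ [[x Dx <-] Ox] <-]|x [Dx Ox]].
      by rewrite h'hK.
    by exists (h x); [split=> //; exists x | exact: h'hK].
  exact: open_embedding_preimage.
Qed.

End OpenEmbedding.

(** * Density and connectedness *)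

Lemma hausdorff_eq_near {S T : topologicalType} (h k : S -> T) (x : S) :
  hausdorff_space T -> {for x, continuous h} -> {for x, continuous k} ->
  (forall P, nbhs x P -> exists2 y, P y & h y = k y) -> h x = k x.
Proof.
move=> hT ch ck hk; apply: hT => A B /ch hA /ck kB.
have [y [/= Ay By] hky] := hk _ (@filterI _ (nbhs x) _ _ _ hA kB).
by exists (h y); split=> //; rewrite hky.
Qed.

(** [W `&` U] is connected and dense in [W `&` V], so a clopen part of the
    latter is determined by its trace on [U]. *)
Lemma portly_superset {T : topologicalType} (U V : set T) :
  portly U -> open V -> U `<=` V -> portly V.
Proof.
move=> [oU dU cU] oV UV; split=> //.
  by move=> O O0 /(dU _ O0) [x [Ox Ux]]; exists x; split=> //; exact: UV.
move=> W oW cW B B0 [C oC BC] [C' cC' BC'].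
(* This is the density of [W `&` U] in [W `&` V]. *)
have meetsU (O : set T) : open O -> (W `&` V `&` O) !=set0 ->
    exists x, [/\ W x, U x & O x].
  move=> oO /(dU _)[|x [[[Wx _] Ox] Ux]]; last by exists x.
  by apply: openI => //; exact: openI.
have BU : B `&` U = W `&` U.
  apply: cU => //.
  - have [x [Wx Ux Cx]] := meetsU C oC ltac:(by rewrite -BC).
    by exists x; rewrite BC; do !split=> //; exact: UV.
  - exists C => //; rewrite BC; apply/seteqP; split=> x.
      by move=> [[[Wx _] Cx] Ux].
    by move=> [[Wx Ux] Cx]; do !split=> //; exact: UV.
  - exists C' => //; rewrite BC'; apply/seteqP; split=> x.
      by move=> [[[Wx _] Cx] Ux].
    by move=> [[Wx Ux] Cx]; do !split=> //; exact: UV.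
apply/seteqP; split=> [x|x WVx]; first by rewrite BC => -[].
apply: contrapT => nBx.
have [||y [Wy Uy nCy]] := meetsU (~` C').
- by rewrite openC.
- by exists x; split=> // C'x; apply: nBx; rewrite BC'.
- apply: nCy; have : (W `&` U) y by [].
  by rewrite -BU BC' => -[[]].
Qed.

(** * Germs of elements of the group *)

Section Germs.
Context {G : groupType} {X : topologicalType} {act : G -> X -> X}.
Hypothesis hGX : analytical_structure act.

Lemma act_cancel (g : G) : cancel (act g) (act g^-1%g).
Proof.
have [_ [act1 actM] _ _ _] := hGX.
by move=> x; rewrite -actM mulVg act1.
Qed.

Lemma act_open_embedding (g : G) : open_embedding [set: X] (act g).
Proof.
have [_ [act1 actM] cact _ _] := hGX.
split=> [|x y _ _|x _|O oO]; first exact: openT.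
- exact/can_inj/act_cancel.
- exact: cact.
have -> : act g @` ([set: X] `&` O) = act g^-1%g @^-1` O.
  rewrite setTI; apply/seteqP; split=> [_ [x Ox <-]|x Ox].
    by rewrite /= act_cancel.
  by exists (act g^-1%g x) => //; rewrite -actM mulgV act1.
by move/continuousP: (cact g^-1%g); exact.
Qed.

Definition germ_in_group {M : topologicalType} (phi psi : M -> X) (x : M) :=
  exists g : G, \forall y \near x, psi y = act g (phi y).

Lemma germ_in_group_refl {M : topologicalType} (phi : M -> X) (x : M) :
  germ_in_group phi phi x.
Proof.
have [_ [act1 _] _ _ _] := hGX.
by exists 1%g; apply: nearW => y; rewrite act1.
Qed.

Lemma germ_in_group_sym {M : topologicalType} (phi psi : M -> X) (x : M) :
  germ_in_group phi psi x -> germ_in_group psi phi x.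
Proof.
move=> [g near_x]; exists g^-1%g; apply: filterS near_x => y ->.
by rewrite act_cancel.
Qed.

(** An open embedding [phi] identifies the neighbourhoods of [phi x] in
    [phi @` D] with those of [x] in [D], so the change of charts can be read on
    [M] instead of [X], and the set [D] no longer matters. *)
Lemma locally_in_groupP {M : topologicalType} {E D : set M}
    {phi : M -> X} (psi : M -> X) {x : M} :
  open_embedding E phi -> open D -> D `<=` E -> D x ->
  locally_in_group act D phi psi x <-> germ_in_group phi psi x.
Proof.
move=> phiE oD DE Dx; have [oE injphi _ _] := phiE.
split=> [[g [O [oO Ox OD eq_g]]]|[g near_x]]; exists g.
  have : nbhs x (D `&` phi @^-1` O).
    apply: open_nbhs_nbhs; split=> //.
    by apply: open_embedding_preimage oO; exact: open_embedding_sub phiE oD DE.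
  by apply: filterS => y [Dy Oy]; exact: eq_g.
have : nbhs x [set y | psi y = act g (phi y)] by [].
rewrite nbhsE => -[P [oP Px] eq_g].
exists (phi @` (D `&` P)); split.
- apply: open_embedding_image phiE _ _; first exact: openI.
  by move=> y [/DE].
- by exists x.
- by move=> _ [y [Dy _] <-]; exists y.
- move=> y Dy [z [Dz Pz] /injphi zy]; apply: eq_g.
  by rewrite -zy ?inE //; exact: DE.
Qed.

(** The two elements agree on the image by [phi] of a neighbourhood of [x],
    which is a nonempty open set of [X]. *)
Lemma germ_in_group_unique {M : topologicalType} (E : set M)
    (phi psi : M -> X) (x : M) (g h : G) :
  open_embedding E phi -> E x ->
  (\forall y \near x, psi y = act g (phi y)) ->
  (\forall y \near x, psi y = act h (phi y)) -> act g = act h.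
Proof.
move=> phiE Ex gx hx; have [_ _ _ _ act_eq] := hGX.
have [P [oP Px] PE] : exists2 P, open_nbhs x P &
    P `<=` [set y | act g (phi y) = act h (phi y)] `&` E.
  have Ex' : nbhs x E by apply: open_nbhs_nbhs; split=> //; case: phiE.
  have : nbhs x
      ([set y | psi y = act g (phi y) /\ psi y = act h (phi y)] `&` E).
    by apply: filterI => //; exact: filterI gx hx.
  rewrite nbhsE => -[P Px PE].
  by exists P => // y /PE [[/= -> eq_h] Ey]; split.
apply: funext; apply: (act_eq g h (phi @` P)).
- by apply: open_embedding_image phiE oP _ => y /PE [].
- by exists (phi x); exists x.
- by move=> _ /set_mem[y /PE [eq_gh _] <-].
Qed.

(** By uniqueness of germs, the open sets on which [psi] is given by distinct
    homeomorphisms [act h] have disjoint traces on [S]; being connected and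
    covered by them, [S] lies in only one. *)
Lemma analytic_continuation {M : topologicalType} (E S : set M)
    (phi psi : M -> X) :
  open_embedding E phi -> S `<=` E -> connected S -> S !=set0 ->
  (forall x, S x -> germ_in_group phi psi x) ->
  exists g : G, forall x, S x -> psi x = act g (phi x).
Proof.
move=> phiE SE cS [x0 Sx0] germS; have [g germ_g] := germS x0 Sx0.
pose C h := interior [set y | psi y = act h (phi y)].
have Cx h x : C h x -> \forall y \near x, psi y = act h (phi y) by [].
exists g => x Sx.
suff : (S `&` C g) x by move=> [_ /Cx/nbhs_singleton].
suff -> : S `&` C g = S by [].
apply: cS; first by exists x0.
- by exists (C g) => //; exact: open_interior.
(* In [S], the complement of [C g] is the union of the other [C h]. *)
exists (~` \bigcup_(h in [set h | act h <> act g]) C h).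
  by apply: open_closedC; apply: bigcup_open => h _; exact: open_interior.
apply/seteqP; split=> y [Sy].
  move=> Cgy; split=> // -[h /= neq_hg Chy]; apply: neq_hg.
  by apply: germ_in_group_unique phiE (SE _ Sy) (Cx _ _ Chy) (Cx _ _ Cgy).
move=> notC; split=> //; have [h germ_h] := germS y Sy.
have [eq_hg|neq_hg] := pselect (act h = act g); last by case: notC; exists h.
by rewrite /C -eq_hg.
Qed.

End Germs.

(** * The maximal atlas of a singular manifold *)

Section RegularLocus.
Context {G : groupType} {X : topologicalType} {act : G -> X -> X}.
Hypothesis hGX : analytical_structure act.

Section Charts.
Variable M : singular_manifold act.

Lemma Reg_portly : portly (Reg M).
Proof. by have [[]] := sm_maximal M. Qed.

Lemma sm_atlas_embedding (c : chart M X) :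
  sm_atlas M c -> open_embedding (dom c) (coord c).
Proof.
move=> Ac; have [[_ [charts _ _]] _] := sm_maximal M.
by have [chart_c _] := charts c Ac; apply/homeomorphism_open_embedding.
Qed.

Lemma sm_atlas_sub (c : chart M X) : sm_atlas M c -> dom c `<=` Reg M.
Proof.
move=> Ac; have [[_ [charts _ _]] _] := sm_maximal M.
by have [] := charts c Ac.
Qed.

Lemma sm_atlas_cover (x : M) : Reg M x -> exists2 c, sm_atlas M c & dom c x.
Proof.
by have [[_ [_ cover _]] _] := sm_maximal M => /cover [c Ac cx]; exists c.
Qed.

Lemma sm_atlas_germ (c d : chart M X) (x : M) :
  sm_atlas M c -> sm_atlas M d -> dom c x -> dom d x ->
  germ_in_group (act := act) (coord c) (coord d) x.
Proof.
move=> Ac Ad cx dx; have [[_ [_ _ compat]] _] := sm_maximal M.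
have [oc _ _ _] := sm_atlas_embedding c Ac.
have [od _ _ _] := sm_atlas_embedding d Ad.
apply/(locally_in_groupP _ (sm_atlas_embedding c Ac) (openI oc od)).
- by move=> y [].
- by [].
- exact: compat.
Qed.

(** Maximality bears on the portly domain and on the atlas at the same time:
    the domain of [e] may stick out of [Reg M], because its union with [Reg M]
    is still portly. *)
Lemma sm_atlas_maximal (e : chart M X) :
  open_embedding (dom e) (coord e) ->
  (forall (c : chart M X) (x : M), sm_atlas M c -> dom c x -> dom e x ->
    germ_in_group (act := act) (coord c) (coord e) x) ->
  sm_atlas M e.
Proof.
move=> emb_e germ_e; have [[_ [charts _ _]] maxM] := sm_maximal M.
have [oe _ _ _] := emb_e; have [oM _ _] := Reg_portly.
suff ae : ae_structure act (Reg M `|` dom e) (sm_atlas M `|` [set e]).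
  have [||_ <-] := maxM _ _ ae; try exact: subsetUl.
  by right.
split; first by apply: portly_superset Reg_portly _ _;
  [exact: openU | exact: subsetUl].
have emb c : (sm_atlas M `|` [set e]) c -> open_embedding (dom c) (coord c).
  by move=> [/sm_atlas_embedding//|->].
split.
- move=> c Ac; split; first by apply/homeomorphism_open_embedding/emb.
  by case: Ac => [/sm_atlas_sub|->] x; [left; auto | right].
- move=> x [/sm_atlas_cover [c Ac cx]|ex]; first by exists c; [left|].
  by exists e; [right|].
move=> c d Ac Ad x cx dx.
have [oc _ _ _] := emb c Ac; have [od _ _ _] := emb d Ad.
apply/(locally_in_groupP _ (emb c Ac) (openI oc od)) => //.
case: Ac cx => [Ac|->] cx; case: Ad dx => [Ad|->] dx.
- exact: sm_atlas_germ.
- exact: germ_e.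
- by apply: germ_in_group_sym => //; exact: germ_e.
- exact: germ_in_group_refl.
Qed.

End Charts.

(** * Almost everywhere morphisms *)

Variables (M N : singular_manifold act) (f : M -> N).

Lemma morphism_germ (U : set M) (V : set N) (B : set (chart N X))
    (c : chart M X) (d : chart N X) (x : M) :
  open U -> continuous f ->
  gx_morphism act U (atlas_restr (sm_atlas M) U) V B f ->
  sm_atlas M c -> B d -> open (dom d) -> U x -> dom c x -> dom d (f x) ->
  germ_in_group (act := act) (coord c) (coord d \o f) x.
Proof.
move=> oU cf [_ morU] Ac Bd od Ux cx dfx.
have emb_c := sm_atlas_embedding M c Ac; have [oc _ _ _] := emb_c.
have AUc : atlas_restr (sm_atlas M) U (Chart (dom c `&` U) (coord c)).
  by exists c.
have := morU _ _ AUc Bd x (conj cx Ux) dfx.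
apply: (iffLR (locally_in_groupP _ emb_c _ _ _)) => //=.
- by apply: openI; [exact: openI | move/continuousP: cf; exact].
- by move=> y [[]].
Qed.

(** A.e. morphisms are morphisms wherever charts are available at the source
    and at the target: the identity [d \o f = g \o c], known locally on the
    portly set [U], holds on [W `&` U] with a single [g] by analytic
    continuation, then on [W] by density. *)
Lemma ae_morphism_germ (c : chart M X) (d : chart N X) (x : M) :
  ae_morphism f -> sm_atlas M c -> sm_atlas N d -> dom c x -> dom d (f x) ->
  germ_in_group (act := act) (coord c) (coord d \o f) x.
Proof.
move=> [cf [U [V [[pU _] [[oV _ _] _] morU]]]] Ac Ad cx dfx.
have [oU dU connU] := pU; have [[_ _ hX] _ cact _ _] := hGX.
have emb_c := sm_atlas_embedding M c Ac; have [oc _ contc _] := emb_c.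
have emb_d := sm_atlas_embedding N d Ad; have [od _ contd _] := emb_d.
have [W [oW connW Wx WE]] : exists W : set M,
    [/\ open W, connected W, W x & W `<=` dom c `&` f @^-1` dom d].
  apply: sm_locally_connected; apply: open_nbhs_nbhs; split=> //.
  by apply: openI => //; move/continuousP: cf; exact.
have [g eq_g] : exists g : G, forall y, (W `&` U) y ->
    (coord d \o f) y = act g (coord c y).
  apply: (analytic_continuation hGX _ _ _ _ emb_c).
  - by move=> y [/WE []].
  - exact: connU.
  - by apply: dU => //; exists x.
  move=> y [Wy Uy]; have [cy dfy] := WE y Wy.
  apply: (@morphism_germ U V _ c (Chart (dom d `&` V) (coord d)) y) => //=.
  - exact: morU.
  - by exists d.
  - exact: openI.
  - by split=> //; case: morU => + _; exact.
exists g; have : nbhs x W by apply: open_nbhs_nbhs.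
apply: filterS => y Wy; have [cy dfy] := WE y Wy.
apply: (hausdorff_eq_near _ (act g \o coord c)) => //.
- by apply: continuous_comp; [exact: cf | apply: contd; rewrite inE].
- by apply: continuous_comp; [apply: contc; rewrite inE | exact: cact].
move=> P; rewrite nbhsE => -[O [oO Oy] OP].
have [|z [[Oz Wz] Uz]] := dU (O `&` W) _ (openI oO oW); first by exists y.
by exists z; [exact: OP | exact: eq_g].
Qed.

(** By the previous lemma, regularity of [f] at a point of [Reg M] is only a
    matter of a neighbourhood being sent to [Reg N]. *)
Lemma ae_morphism_regular (x : M) (P : set M) :
  ae_morphism f -> Reg M x -> nbhs x P -> f @` P `<=` Reg N ->
  Reg_morphism f x.
Proof.
move=> hf Mx; rewrite nbhsE => -[W [oW Wx] WP] PN; have [cf _] := hf.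
have [oM _ _] := Reg_portly M.
exists (W `&` Reg M) => //; split; [exact: openI | by move=> y [] |].
split=> [y [/WP Py _]|_ d [c Ac <-] Ad y [/= cy WMy] dfy].
  by apply: PN; exists y.
have emb_c := sm_atlas_embedding M c Ac; have [oc _ _ _] := emb_c.
have [od _ _ _] := sm_atlas_embedding N d Ad.
apply/(locally_in_groupP _ emb_c) => //.
- apply: openI; last by move/continuousP: cf; exact.
  by apply: openI => //; exact: openI.
- by move=> z [[]].
- exact: ae_morphism_germ.
Qed.

(** Near [x], [d \o f] equals [g \o c], which is an open embedding, and [d] is
    one too. *)
Lemma Reg_morphism_local_homeomorphism (x : M) :
  ae_morphism f -> Reg_morphism f x -> local_homeomorphism_at f x.
Proof.
move=> hf [U [oU UM morU] Ux]; have [cf _] := hf; have [_ _ cact _ _] := hGX.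
have [c Ac cx] := sm_atlas_cover M x (UM x Ux).
have [d Ad dfx] : exists2 d, sm_atlas N d & dom d (f x).
  by apply: sm_atlas_cover; case: morU => + _; exact.
have emb_c := sm_atlas_embedding M c Ac; have [oc _ _ _] := emb_c.
have emb_d := sm_atlas_embedding N d Ad; have [od _ _ _] := emb_d.
have [g germ_g] := ae_morphism_germ c d x hf Ac Ad cx dfx.
have : nbhs x (dom c `&` f @^-1` dom d `&`
    [set y | (coord d \o f) y = act g (coord c y)]).
  apply: filterI => //; apply: open_nbhs_nbhs; split=> //.
  by apply: openI => //; move/continuousP: cf; exact.
rewrite nbhsE => -[W [oW Wx] WE].
suff : open_embedding W f.
  by move/homeomorphism_open_embedding => [? ? ?]; exists W.
apply: open_embedding_cancel emb_d _ _.
- by move=> y _; exact: cf.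
- by move=> _ [y /WE [[_ ?] _] <-].
apply: (open_embedding_eq _ (act g \o coord c)).
  by move=> y /set_mem/WE [_ ->].
apply: open_embedding_comp (act_open_embedding hGX g) _ => //.
by apply: open_embedding_sub emb_c oW _ => y /WE [[]].
Qed.

(** The charts of [M] around [x], transported by [f], are charts of [N]; they
    are compatible with the atlas of [N] by [ae_morphism_germ], hence belong
    to it by maximality. *)
Lemma local_homeomorphism_regular_value (x : M) :
  ae_morphism f -> Reg M x -> local_homeomorphism_at f x ->
  exists2 P, nbhs x P & f @` P `<=` Reg N.
Proof.
move=> hf Mx [W [oW Wx ofW homeoW]].
have [c Ac cx] := sm_atlas_cover M x Mx.
have emb_c := sm_atlas_embedding M c Ac; have [oc _ _ _] := emb_c.
pose P := W `&` dom c; have oP : open P by exact: openI.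
have emb_f : open_embedding P f.
  apply: (open_embedding_sub W) => //; last by move=> y [].
  exact/homeomorphism_open_embedding.
have [_ injf _ _] := emb_f.
(* The inverse of [f] on [P], with the default value [x] outside [f @` P]. *)
pose f' (y : N) := xget x [set z | P z /\ f z = y].
have f'K : {in P, cancel f f'}.
  move=> z Pz; have [|Pf' ff'] := @xgetPex M x [set w | P w /\ f w = f z].
    by exists z; split=> //; exact/set_mem.
  by apply: injf => //; exact: mem_set.
have emb_f' := open_embedding_inverse _ _ _ emb_f f'K.
have f'P y : (f @` P) y -> P (f' y).
  by move=> [z Pz <-]; rewrite f'K ?inE.
pose e := Chart (f @` P) (coord c \o f').
have Ae : sm_atlas N e.
  apply: sm_atlas_maximal => [|d _ Ad /[swap] -[z Pz <-] dfz].
    apply: open_embedding_comp emb_f' emb_c _.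
    by move=> _ [y /f'P [_ cf'y] <-].
  have [g germ_g] := germ_in_group_sym hGX _ _ _
    (ae_morphism_germ c d z hf Ac Ad (proj2 Pz) dfz).
  exists g.
  have near_fz : nbhs (f z) (f @` P).
    apply: open_nbhs_nbhs; split; last by exists z.
    exact: open_embedding_image emb_f oP _.
  have cont_f' : {for f z, continuous f'}.
    by case: emb_f' => _ _ + _; apply; rewrite inE; exists z.
  have near_f' : nbhs (f' (f z)) [set y | coord c y = act g ((coord d \o f) y)].
    by rewrite f'K ?inE.
  apply: filterS (filterI near_fz (cont_f' _ near_f')) => _ [[w Pw <-]] /= ->.
  by rewrite f'K ?inE.
exists P; first exact: open_nbhs_nbhs.
exact: sm_atlas_sub Ae.
Qed.

End RegularLocus.

Theorem proposition3p11 (G : groupType) (X : topologicalType)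
    (act : G -> X -> X) (hGX : analytical_structure act)
    (M N : singular_manifold act) (f : M -> N) (hf : ae_morphism f) :
  Reg_morphism f = Reg M `&` [set x | local_homeomorphism_at f x].
Proof.
apply/seteqP; split=> [x fx|x [Mx homeo_x]].
  split; first by have [U [_ + _]] := fx; exact.
  exact: Reg_morphism_local_homeomorphism.
have [P nP PN] := local_homeomorphism_regular_value hGX M N f x hf Mx homeo_x.
exact: ae_morphism_regular hf Mx nP PN.
Qed.
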